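(* There exists a compact set $K\subseteq\mathbb{R}^2$ of two-dimensional Lebesgue measure $0$ and a constant $c>0$ with the following property: for every $a\in[1,2]$ there exist $(x_1,x_2)\in\mathbb{R}^2$ and an interval $I_a\subseteq[0,1]$ of length at least $c$ such that $\{(x_1+t,\,x_2+at^2): t\in I_a\}\subseteq K$ (that is, $K$ contains a piece of length $\sim 1$ of a parabola of every aperture $a\in[1,2]$). Moreover, there is a constant $C$ such that the vertical $\delta$-thickening of $K$ satisfies $|K(\delta)|\le C(\log \delta^{-1})^{-2}$ for all sufficiently small $\delta>0$. Consequently, for all $p,q\in[1,\infty]$ there is a constant $c_{p,q}>0$ independent of $\delta$ such that $$B(p,q,\delta)\ge c_{p,q}(\log\delta^{-1})^{2/p}$$ for all sufficiently small $\delta>0$.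
   Context: For $S\subseteq\mathbb{R}^2$ and $\delta>0$, the vertical $\delta$-thickening is $S(\delta):=\{x+(0,\varepsilon): x\in S,\ -\delta\le\varepsilon\le\delta\}$. For a function $g:\mathbb{R}^2\to\mathbb{C}$, $\delta>0$ and $a\in[1,2]$, define the thickened parabolic maximal function $$\mathcal P_\delta g(a)=\sup_{(x_1,x_2)\in\mathbb{R}^2}(2\delta)^{-1}\int_0^1\int_{-\delta}^{\delta}|g(x_1+t,\,x_2+at^2+s)|\,ds\,dt,$$ and for $p,q\in[1,\infty]$ let $B(p,q,\delta)=\sup_{g\neq 0}\|\mathcal P_\delta g\|_{L^q([1,2])}/\|g\|_{L^p(\mathbb{R}^2)}$. $|\cdot|$ denotes Lebesgue measure. *)

(* Defs.v *)
From mathcomp Require Import all_boot all_order all_algebra.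
From mathcomp Require Import all_classical all_reals all_analysis.
Set Implicit Arguments. Unset Strict Implicit. Unset Printing Implicit Defensive.
Import Order.TTheory GRing.Theory Num.Theory numFieldNormedType.Exports.
Local Open Scope classical_set_scope.
Local Open Scope ring_scope.

Definition leb2 {R : realType} :=
  ((@lebesgue_measure R) \x (@lebesgue_measure R))%E.

Definition vthicken {R : realType} (S : set (R * R)) (delta : R) : set (R * R) :=
  [set y | exists x, S x /\ exists e : R, - delta <= e <= delta /\ y = (x.1, x.2 + e)].

Definition Pmax {R : realType} (delta : R) (g : R * R -> R) (a : R) : \bar R :=
  ereal_sup [set (((2 * delta)^-1)%:E *
      (\int[@lebesgue_measure R]_(t in `[0%R, 1%R])
         \int[@lebesgue_measure R]_(s in `[(- delta)%R, delta])
            (`| g (x.1 + t, x.2 + a * t ^+ 2 + s) |)%:E))%E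
    | x in [set: R * R]].

Definition Pmax12 {R : realType} (delta : R) (g : R * R -> R) (a : R) : \bar R :=
  if (1 <= a <= 2) then Pmax delta g a else 0%E.

Definition Bpq {R : realType} (p q : \bar R) (delta : R) : \bar R :=
  ereal_sup [set (Lnorm (@lebesgue_measure R) q (Pmax12 delta g)
                  * ((fine (Lnorm leb2 p (fun x => (g x)%:E)))^-1)%:E)%E
    | g in [set g : R * R -> R | measurable_fun setT g /\
              (0 < Lnorm leb2 p (fun x => (g x)%:E) < +oo)%E]].

Definition two_over {R : realType} (p : \bar R) : R :=
  match p with
  | r%:E => 2 / r
  | _ => 0
  end.

(* Main.v *)
(* Write a = sum_j w_j 2^-j in binary and take the parabola
   p_a(x) = sum_j w_j 2^-j (x - x_j)^2, which has aperture a; its vertex is a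
   weighted mean of the nodes x_j. The nodes sweep [0, 1) at every resolution:
   x_(2^m + i) = i / 2^m for i < 2^m. For x in [0, 1/2] near i / 2^m put
   k = 2^m + i. The 2^k choices of the first k digits determine p_a(x) up to
   the tail sum_(j >= k) 2^-j (x - x_j)^2, which is O(2^-k 4^-m) because
   |x - x_j| = O((j - k + 1) / 2^m). So the values at x lie in 2^k intervals of
   total length O(4^-m). Choosing m with 2^m comparable to log(1/d) gives the
   measure bound for the d-thickening, and the indicator function of the
   thickened strips gives the lower bound for the maximal operator. *)

Require Import Defs.
From mathcomp Require Import all_boot all_order all_algebra.
From mathcomp Require Import all_classical all_reals all_analysis.
From mathcomp Require Import measurable_realfun ess_sup_inf ring lra zify.
Set Implicit Arguments. Unset Strict Implicit. Unset Printing Implicit Defensive.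
Import Order.TTheory GRing.Theory Num.Theory numFieldNormedType.Exports.
Local Open Scope classical_set_scope.
Local Open Scope ring_scope.

(** * Dyadic nodes, weighted sums of parabolas, binary digits *)

Section Digits.
Context {R : realType}.
Implicit Types (x a : R) (w : nat -> bool) (m i j k n : nat).

(** Truncated subtraction gives [node 0 = 0], although index 0 lies in no dyadic block. *)
Definition node j : R :=
  (j - 2 ^ trunc_log 2 j)%N%:R / 2 ^+ trunc_log 2 j.

Lemma node_ge0 j : 0 <= node j.
Proof. by rewrite divr_ge0// exprn_ge0. Qed.

Lemma node_le1 j : node j <= 1.
Proof.
rewrite ler_pdivrMr ?exprn_gt0// mul1r -natrX ler_nat leq_subLR addnn -mul2n.
by rewrite -expnS; exact/ltnW/trunc_log_ltn.
Qed.

Lemma node_small j : (j < 3)%N -> node j = 0.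
Proof. by case: j => [|[|[|]]]//; rewrite /node/= mul0r. Qed.

Lemma node_block m j : (2 ^ m <= j < 2 ^ m.+1)%N ->
  node j = (j%:R - 2 ^+ m) / 2 ^+ m.
Proof.
move=> jm; rewrite /node (trunc_log_eq _ jm)//.
by case/andP: jm => jm _; rewrite natrB// natrX.
Qed.

(** Inside block [m] consecutive nodes are [2 ^- m] apart, so each index past [2 ^ m + i] adds that
    much. In later blocks the distance is at most 1, which suffices: since [i <= 2 ^ m.-1], at least
    half a block has been passed and the right-hand side exceeds 1. *)
Lemma node_dist m i j x : (0 < m)%N -> (i <= 2 ^ m.-1)%N ->
  0 <= x <= 2^-1 -> `|x - i%:R / 2 ^+ m| <= 2 ^- m -> (2 ^ m + i <= j)%N ->
  `|x - node j| <= 2 * (j - (2 ^ m + i)).+1%:R / 2 ^+ m.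
Proof.
move=> m0 im xh xi kj; have p0 : 0 < 2 ^+ m :> R by rewrite exprn_gt0.
have [jm|jm] := ltnP j (2 ^ m.+1); last first.
  apply: (@le_trans _ _ 1).
    by move: (node_ge0 j) (node_le1 j); rewrite ler_norml; lra.
  rewrite ler_pdivlMr// mul1r -natrX -natrM ler_nat.
  case: m m0 im xi kj jm p0 => // m _ /= im _ kj jm _.
  by move: im kj jm; rewrite !expnS; lia.
have jm1 : (2 ^ m <= j < 2 ^ m.+1)%N by rewrite jm andbT (leq_trans _ kj)// leq_addr.
rewrite (node_block jm1) -[j in (j%:R - _)](subnKC kj) -natr1.
set l := (j - _)%N; have l0 : 0 <= l%:R :> R by [].
have -> : x - ((2 ^ m + i + l)%N%:R - 2 ^+ m) / 2 ^+ m =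
  (x - i%:R / 2 ^+ m) - l%:R / 2 ^+ m.
  by rewrite !natrD natrX; field; rewrite gt_eqF.
apply: (le_trans (ler_normB _ _)).
rewrite (ger0_norm (divr_ge0 l0 (ltW p0))).
apply: (@le_trans _ _ (2 ^- m + l%:R / 2 ^+ m)); first by rewrite lerD2r.
rewrite -[X in X + _]mul1r -mulrDl ler_pM2r ?invr_gt0//; lra.
Qed.

(** Induction on a closed form of the partial sums; 12 is the value of the full series. *)
Lemma sum_sq_geometric n :
  \sum_(l < n) l.+1%:R ^+ 2 * 2^-1 ^+ l <= 12 :> R.
Proof.
suff -> : \sum_(l < n) l.+1%:R ^+ 2 * 2^-1 ^+ l =
    12 - (2 * n%:R ^+ 2 + 8 * n%:R + 12) * 2^-1 ^+ n :> R.
  by rewrite gerBl mulr_ge0// ?exprn_ge0// !addr_ge0// mulr_ge0.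
elim: n => [|n IH]; first by rewrite big_ord0 expr0; ring.
rewrite big_ord_recr/= IH -[n.+1%:R]natr1 [2^-1 ^+ n.+1]exprS.
by move: (2^-1 ^+ n) => h; field.
Qed.

(* The coefficients of [psum] as a polynomial in x, see [psumE]. *)
Definition digsum w k : R := \sum_(j < k) (w j)%:R * 2^-1 ^+ j.
Definition digsum1 w k : R := \sum_(j < k) (w j)%:R * 2^-1 ^+ j * node j.
Definition digsum2 w k : R := \sum_(j < k) (w j)%:R * 2^-1 ^+ j * node j ^+ 2.

Definition psum k (u : 'I_k -> bool) x : R :=
  \sum_(j < k) (u j)%:R * 2^-1 ^+ j * (x - node j) ^+ 2.

Lemma psumE w k x : psum (fun j : 'I_k => w j) x =
  digsum w k * x ^+ 2 - 2 * x * digsum1 w k + digsum2 w k.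
Proof.
rewrite /psum /digsum /digsum1 /digsum2 mulr_suml mulr_sumr -sumrB -big_split/=.
by apply: eq_bigr => j _; ring.
Qed.

(** Squaring [node_dist] gives a factor [4 / 4 ^+ m], and the remaining series is bounded by 12,
    whence 48. Uniformity in [n] lets the bound pass to the limit. *)
Lemma psum_tail m i w x n : (0 < m)%N -> (i <= 2 ^ m.-1)%N ->
  0 <= x <= 2^-1 -> `|x - i%:R / 2 ^+ m| <= 2 ^- m ->
  `|psum (fun j : 'I_(2 ^ m + i + n) => w j) x -
    psum (fun j : 'I_(2 ^ m + i) => w j) x|
  <= 48 / 4 ^+ m * 2^-1 ^+ (2 ^ m + i).
Proof.
move=> m0 im xh xi; rewrite /psum big_split_ord/= addrAC subrr add0r.
rewrite ger0_norm; last first.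
  by apply: sumr_ge0 => l _; apply: mulr_ge0; rewrite ?sqr_ge0// mulr_ge0 ?exprn_ge0.
apply: (@le_trans _ _ (\sum_(l < n) (4 / 4 ^+ m * 2^-1 ^+ (2 ^ m + i)) *
    (l.+1%:R ^+ 2 * 2^-1 ^+ l))); last first.
  rewrite -mulr_sumr (_ : 48 / _ * _ = 4 / 4 ^+ m * 2^-1 ^+ (2 ^ m + i) * 12).
    by rewrite ler_wpM2l ?sum_sq_geometric// mulr_ge0 ?divr_ge0 ?exprn_ge0.
  by move: (2^-1 ^+ _) => h; field; rewrite expf_neq0.
apply: ler_sum => l _.
have := node_dist m0 im xh xi (leq_addr l (2 ^ m + i)).
rewrite addKn => h.
have {}h : (x - node (2 ^ m + i + l)) ^+ 2 <= 4 / 4 ^+ m * l.+1%:R ^+ 2.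
  rewrite -real_normK ?num_real//.
  have -> : 4 / 4 ^+ m * l.+1%:R ^+ 2 = (2 * l.+1%:R / 2 ^+ m) ^+ 2 :> R.
    rewrite (_ : 4 = 2 * 2 :> R); last by ring.
    by rewrite exprMn; field; rewrite expf_neq0.
  by rewrite lerXn2r// nnegrE// divr_ge0 ?mulr_ge0// exprn_ge0.
rewrite exprD.
apply: (@le_trans _ _ (1 * (2^-1 ^+ (2 ^ m + i) * 2^-1 ^+ l) *
    (4 / 4 ^+ m * l.+1%:R ^+ 2))); last first.
  by rewrite le_eqVlt; apply/orP; left; apply/eqP; ring.
apply: ler_pM; rewrite ?sqr_ge0//.
by apply: ler_wpM2r; [rewrite mulr_ge0 ?exprn_ge0|case: (w _)].
Qed.

(** Greedy expansion: [f] removes the current digit and doubles the remainder, which stays in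
    [0, 2]. The first digit has weight 1, so the expansions reach up to 2. *)
Lemma binary_digits a : 0 <= a <= 2 ->
  exists w, forall k, digsum w k <= a <= digsum w k + 2 * 2^-1 ^+ k.
Proof.
move=> a02; pose f (r : R) := if 1 <= r then 2 * (r - 1) else 2 * r.
pose r k := iter k f a.
have rS k : r k.+1 = f (r k) by [].
have r02 k : 0 <= r k <= 2.
  elim: k => [//|k]; rewrite rS /f.
  by case: (lerP 1 (r k)) => /=; lra.
exists (fun k => 1 <= r k) => k.
have : a = digsum (fun k => 1 <= r k) k + r k * 2^-1 ^+ k.
  elim: k => [|k IH]; first by rewrite /digsum big_ord0 expr0 mulr1 add0r.
  rewrite {1}IH /digsum big_ord_recr rS /f/= [2^-1 ^+ k.+1]exprS.
  by move: (2^-1 ^+ k) => h; case: (lerP 1 (r k)) => /= _; field.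
move: (digsum _ _) => b aE; have /andP[r0 r2] := r02 k.
have h0 : 0 <= 2^-1 ^+ k :> R by rewrite exprn_ge0.
by move: (mulr_ge0 r0 h0) (ler_wpM2r h0 r2) aE; lra.
Qed.

End Digits.

(** * The strips and the compact set they cut out *)

Section Strips.
Context {R : realType}.
Implicit Types (x a d : R) (w : nat -> bool) (m i j k n : nat).

(* The strict inequality makes [strip m d] closed while every x in [0, 1/2]
   still has some i to which the condition applies. *)
Definition strip m d : set (R * R) :=
  [set z | 0 <= z.1 <= 2^-1 /\ forall i, (i <= 2 ^ m.-1)%N ->
    `|z.1 - i%:R / 2 ^+ m| < 2 ^- m ->
    exists u : {ffun 'I_(2 ^ m + i) -> bool},
      `|z.2 - psum u z.1| <= 48 / 4 ^+ m * 2^-1 ^+ (2 ^ m + i) + d].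

(** An intersection of strips instead of a union of parabolas: closedness is inherited from the
    strips, and every measure bound follows from inclusion in one strip. The box provides
    boundedness. *)
Definition kakeya : set (R * R) :=
  (`[0, 2^-1] `*` `[0, 2]) `&` \bigcap_(m in [set m | (0 < m)%N]) strip m 0.

Lemma nondecreasing_partial_sum (u : nat -> R) : (forall j, 0 <= u j) ->
  nondecreasing_seq (fun n => \sum_(j < n) u j).
Proof.
by move=> u0; apply/nondecreasing_seqP => n; rewrite big_ord_recr/= lerDl.
Qed.

Lemma digit_ge0 w j : 0 <= (w j)%:R * 2^-1 ^+ j :> R.
Proof. by rewrite mulr_ge0// exprn_ge0. Qed.

Lemma nondecreasing_digsum1 w : nondecreasing_seq (@digsum1 R w).
Proof.
suff u0 j : 0 <= (w j)%:R * 2^-1 ^+ j * node j :> R.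
  exact: nondecreasing_partial_sum u0.
by rewrite mulr_ge0 ?digit_ge0 ?node_ge0.
Qed.

Lemma nondecreasing_digsum2 w : nondecreasing_seq (@digsum2 R w).
Proof.
suff u0 j : 0 <= (w j)%:R * 2^-1 ^+ j * node j ^+ 2 :> R.
  exact: nondecreasing_partial_sum u0.
by apply: mulr_ge0; rewrite ?digit_ge0 ?sqr_ge0.
Qed.

Lemma digsum2_le_digsum w n : digsum2 w n <= digsum w n :> R.
Proof.
apply: ler_sum => j _; rewrite ler_piMr ?digit_ge0//.
by rewrite exprn_ile1 ?node_ge0 ?node_le1.
Qed.

(** The first three nodes vanish and the weights from index 3 on add up to 1/4. For aperture at
    least 1 this keeps the vertex in [0, 1/4], so an arc of width 1/4 to its right stays over
    [0, 1/2]. *)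
Lemma digsum1_le w n : digsum1 w n <= 4^-1 :> R.
Proof.
apply: (@le_trans _ _ (digsum1 w n.+3)).
  by apply: nondecreasing_digsum1; rewrite -addn3 leq_addr.
suff : digsum1 w n.+3 <= 4^-1 - 4^-1 * 2^-1 ^+ n :> R.
  by have : 0 <= 2^-1 ^+ n :> R by [rewrite exprn_ge0]; lra.
elim: n => [|n IH].
  by rewrite /digsum1 !big_ord_recr big_ord0/= !node_small// !mulr0; lra.
rewrite /digsum1 big_ord_recr/= -/(digsum1 w n.+3).
have : (w n.+3)%:R * 2^-1 ^+ n.+3 * node n.+3 <= 8^-1 * 2^-1 ^+ n :> R.
  have -> : 8^-1 * 2^-1 ^+ n = 2^-1 ^+ n.+3 :> R.
    by rewrite !exprS; move: (2^-1 ^+ n) => h; field.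
  apply: (@le_trans _ _ (2^-1 ^+ n.+3 * node n.+3)).
    rewrite ler_wpM2r ?node_ge0// ler_piMl ?exprn_ge0//.
    by case: (w _).
  by rewrite ler_piMr ?exprn_ge0 ?node_le1.
by move: IH; rewrite [2^-1 ^+ n.+1]exprS; lra.
Qed.

(** With the binary digits of [a], the three coefficients of the partial sums converge, and the
    limit is a parabola of aperture [a]; membership is checked on partial sums and passed to the
    limit. *)
Lemma kakeya_parabola a : 1 <= a <= 2 ->
  exists x1 x2, 0 <= x1 <= 4^-1 /\
    forall t, 0 <= t <= 4^-1 -> kakeya (x1 + t, x2 + a * t ^+ 2).
Proof.
move=> a12; have a02 : 0 <= a <= 2 by lra.
have [w wa] := binary_digits a02.
have cdigsum : digsum w n @[n --> \oo] --> a.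
  apply: (@squeeze_cvgr _ _ _ _ (fun n => a - 2 * 2^-1 ^+ n) (fun=> a)).
  - by near=> n; move: (wa n); lra.
  - suff : a - 2 * 2^-1 ^+ n @[n --> \oo] --> a - 2 * 0 by rewrite mulr0 subr0.
    apply: cvgB; first exact: cvg_cst.
    apply: cvgM; first exact: cvg_cst.
    by apply: cvg_expr; rewrite ger0_norm; lra.
  - exact: cvg_cst.
have digsum_le n : digsum w n <= 2 :> R by move: (wa n); lra.
have cdigsum1 : cvgn (@digsum1 R w).
  apply: nondecreasing_is_cvgn; first exact: nondecreasing_digsum1.
  by exists 4^-1 => _ [n _ <-]; exact: digsum1_le.
have cdigsum2 : cvgn (@digsum2 R w).
  apply: nondecreasing_is_cvgn; first exact: nondecreasing_digsum2.
  by exists 2 => _ [n _ <-]; exact: le_trans (digsum2_le_digsum _ _) _.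
set B := limn (@digsum1 R w); set C := limn (@digsum2 R w).
have B0 : 0 <= B.
  apply: limr_ge => //; near=> n; apply: sumr_ge0 => j _.
  by rewrite mulr_ge0 ?digit_ge0 ?node_ge0.
have B4 : B <= 4^-1 by apply: limr_le => //; near=> n; exact: digsum1_le.
have a0 : 0 < a by lra.
(* The vertex of [a * x ^+ 2 - 2 * x * B + C], found by completing the square. *)
exists (B / a), (C - B ^+ 2 / a).
have Ba : 0 <= B / a <= 4^-1.
  rewrite divr_ge0//=; last lra.
  by rewrite ler_pdivrMr// (le_trans B4)// ler_peMr//; lra.
split => // t t4; set x := B / a + t; set y := _ + _.
have xh : 0 <= x <= 2^-1 by rewrite /x; lra.
have cp : psum (fun j : 'I_n => w j) x @[n --> \oo] --> y.
  have -> : y = a * x ^+ 2 - 2 * x * B + C.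
    by rewrite /y /x; field; rewrite gt_eqF.
  under eq_fun do rewrite psumE.
  apply: cvgD; last exact: cdigsum2.
  apply: cvgB; first by apply: cvgM => //; exact: cvg_cst.
  by apply: cvgM => //; exact: cvg_cst.
split.
  split; rewrite /= in_itv/=; first exact: xh.
  apply/andP; split.
    rewrite -(cvg_lim _ cp)//; apply: limr_ge; first by apply/cvg_ex; exists y.
    near=> n; apply: sumr_ge0 => j _.
    by apply: mulr_ge0; rewrite ?sqr_ge0 ?digit_ge0.
  rewrite -(cvg_lim _ cp)//; apply: limr_le; first by apply/cvg_ex; exists y.
  near=> n; apply: le_trans (digsum_le n); apply: ler_sum => j _.
  rewrite ler_piMr ?digit_ge0// -real_normK ?num_real// exprn_ile1//.
  by rewrite ler_norml; move: (node_ge0 (R:=R) j) (node_le1 (R:=R) j); lra.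
move=> m /= m0; split => //= i im xi.
(* The digits of [a], cut at the index of the node near [x]; [psum_tail] bounds what was cut off. *)
exists [ffun j : 'I_(2 ^ m + i) => w j]; rewrite addr0.
have -> : psum [ffun j : 'I_(2 ^ m + i) => w j] x =
    psum (fun j : 'I_(2 ^ m + i) => w j) x.
  by apply: eq_bigr => j _; rewrite ffunE.
set k := (2 ^ m + i)%N; set s := psum _ _.
have cs : `|psum (fun j : 'I_n => w j) x - s| @[n --> \oo] --> `|y - s|.
  by apply: cvg_norm; apply: cvgB => //; exact: cvg_cst.
rewrite -(cvg_lim _ cs)//; apply: limr_le; first by apply/cvg_ex; eexists; exact: cs.
exists k => // n /= kn; rewrite -(subnKC kn).
exact: psum_tail m0 im xh (ltW xi).
Unshelve. all: by end_near. Qed.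

Lemma continuous_sum (I : Type) (r : seq I) (f : I -> R -> R) :
  (forall j : I, continuous (f j)) -> continuous (fun x => \sum_(j <- r) f j x).
Proof.
move=> cf x; elim: r => [|j r IH].
  by under eq_fun do rewrite big_nil; exact: cvg_cst.
under eq_fun do rewrite big_cons.
by apply: cvgD; [exact: cf|exact: IH].
Qed.

Lemma continuous_psum k (u : 'I_k -> bool) : continuous (psum (R:=R) u).
Proof.
apply: continuous_sum => j x; apply: cvgM; first exact: cvg_cst.
by apply: cvgM; apply: cvgB; first [exact: cvg_id|exact: cvg_cst].
Qed.

(** Turns the implication into a union with the complement of its premise, and the existential into
    a finite union, so that closedness and measurability can be checked piece by piece. *)
Lemma stripE m d : strip m d =
  [set z | 0 <= z.1 <= 2^-1] `&`
  \bigcap_(i in [set i | (i <= 2 ^ m.-1)%N])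
    ([set z | 2 ^- m <= `|z.1 - i%:R / 2 ^+ m|] `|`
     \bigcup_(u in [set: {ffun 'I_(2 ^ m + i) -> bool}])
      [set z | `|z.2 - psum u z.1| <= 48 / 4 ^+ m * 2^-1 ^+ (2 ^ m + i) + d]).
Proof.
apply/seteqP; split => z /= [zh zi]; split => // i im.
  have [|zlt] := lerP (2 ^- m) `|z.1 - i%:R / 2 ^+ m|; [by left|right].
  by have [u ul] := zi i im zlt; exists u.
move=> zlt; have [/=|[u _ ul]] := zi i im; first by rewrite leNgt zlt.
by exists u.
Qed.

Lemma closed_strip m d : closed (strip m d).
Proof.
rewrite stripE; apply: closedI.
  have -> : [set z : R * R | 0 <= z.1 <= 2^-1] =
      fst @^-1` [set x | 0 <= x] `&` fst @^-1` [set x | x <= 2^-1].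
    by apply/seteqP; split => z /= => [/andP[]|[-> ->]].
  apply: closedI; apply: preimage_closed => [z _|];
    rewrite ?closed_ge ?closed_le//; exact: cvg_fst.
apply: closed_bigI => i _; apply: closedU.
  apply: (@preimage_closed _ _ (fun z : R * R => `|z.1 - i%:R / 2 ^+ m|)
    [set x | 2 ^- m <= x]).
    move=> z _; apply: cvg_norm; apply: cvgB; [exact: cvg_fst|exact: cvg_cst].
  exact: closed_ge.
apply: closed_bigcup => [|u _]; first exact: finite_finset.
apply: (@preimage_closed _ _ (fun z : R * R => `|z.2 - psum u z.1|)
  [set x | x <= 48 / 4 ^+ m * 2^-1 ^+ (2 ^ m + i) + d]); last exact: closed_le.
move=> z _; apply: cvg_norm; apply: cvgB; first exact: cvg_snd.
by apply: continuous_comp; [exact: cvg_fst|exact: continuous_psum].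
Qed.

Lemma compact_kakeya : compact kakeya.
Proof.
apply: compact_closedI.
  by apply: compact_setX; exact: segment_compact.
by apply: closed_bigI => m _; exact: closed_strip.
Qed.

Lemma measurable_strip m d : measurable (strip m d).
Proof.
have mle (f : R * R -> R) r : measurable_fun setT f -> measurable [set z | f z <= r].
  move=> mf; rewrite -[X in measurable X]setTI.
  have -> : [set z | f z <= r] = f @^-1` `]-oo, r].
    by apply/seteqP; split => z /=; rewrite in_itv.
  exact: mf.
have mge (f : R * R -> R) r : measurable_fun setT f -> measurable [set z | r <= f z].
  move=> mf; rewrite -[X in measurable X]setTI.
  have -> : [set z | r <= f z] = f @^-1` `[r, +oo[.
    by apply/seteqP; split => z /=; rewrite in_itv/= andbT.
  exact: mf.
rewrite stripE; apply: measurableI.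
  have -> : [set z : R * R | 0 <= z.1 <= 2^-1] =
      [set z | 0 <= z.1] `&` [set z | z.1 <= 2^-1].
    by apply/seteqP; split => z /= => [/andP[]|[-> ->]].
  by apply: measurableI; [apply: mge|apply: mle]; exact: measurable_fst.
apply: bigcap_measurable => [|i _]; first by exists 0%N.
apply: measurableU.
  apply: mge; apply: measurableT_comp => //.
  by apply: measurable_funB => //; exact: measurable_fst.
apply: fin_bigcup_measurable => [|u _]; first exact: finite_finset.
apply: mle; apply: measurableT_comp => //.
apply: measurable_funB; first exact: measurable_snd.
apply: measurableT_comp; last exact: measurable_fst.
by apply: continuous_measurable_fun; exact: continuous_psum.
Qed.

(** A vertical shift keeps the first coordinate, so the same [i] and digits serve and only the
    tolerance grows. *)
Lemma vthicken_kakeya m d : (0 < m)%N -> vthicken kakeya d `<=` strip m d.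
Proof.
move=> m0 _ [z [[_ /(_ m m0)[zh zm]] [e [ed ->]]]]; split => //= i im zi.
have [u ul] := zm i im zi; exists u.
rewrite addrAC; apply: (le_trans (ler_normD _ _)); apply: lerD.
  by rewrite addr0 in ul.
by rewrite ler_norml.
Qed.

End Strips.

(** * Measure bounds for the strips *)

Section Measures.
Context {R : realType}.
Implicit Types (x d : R) (m i k n : nat) (A B : set (R * R)).

Local Notation leb := (@lebesgue_measure R).

Lemma lebesgue_measure_subset (X Y : set R) : X `<=` Y -> (leb X <= leb Y)%E.
Proof. by move=> XY; exact: le_mu_ext. Qed.

(* The nonnegative integral is a supremum over simple functions, so its
   monotonicity holds without any measurability assumption. *)
Lemma ge0_le_integralW (dT : measure_display) (T : measurableType dT)
    (mu : {measure set T -> \bar R}) (D : set T) (f g : T -> \bar R) :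
  (forall t, D t -> (0 <= f t)%E) -> (forall t, D t -> (f t <= g t)%E) ->
  (\int[mu]_(t in D) f t <= \int[mu]_(t in D) g t)%E.
Proof.
move=> f0 fg; rewrite !ge0_integralE//; last first.
  by move=> t Dt; exact: le_trans (f0 t Dt) (fg t Dt).
apply: ereal_sup_le => _ [h /= hf <-]; exists h => //= t.
apply: le_trans (hf t) _; rewrite !patchE.
by case: ifPn => // /set_mem; exact: fg.
Qed.

(** The measure of sections and the integral over them are both monotone; this is what compares
    thickenings with strips. *)
Lemma leb2_subset A B : A `<=` B -> (leb2 A <= leb2 B)%E.
Proof.
move=> AB; apply: ge0_le_integralW => x _ /=; first exact: measure_ge0.
apply: lebesgue_measure_subset => y; rewrite /xsection /= !inE; exact: AB.
Qed.

Lemma lebesgue_measure_segment (a b : R) : a <= b ->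
  leb `[a, b] = (b - a)%:E.
Proof.
move=> ab; rewrite lebesgue_measure_itv/= lte_fin; case: ltP => // ba.
by have -> : a = b by [apply/le_anti/andP]; rewrite subrr.
Qed.

Lemma psum0 k x : psum (fun _ : 'I_k => false) x = 0.
Proof. by rewrite /psum big1// => j _; rewrite !mul0r. Qed.

(** One admissible [i] already covers the section by [2 ^ k] intervals of radius [r], where [k] is
    at most [2 ^ m + 2 ^ m.-1]. The factor [2 ^ k] cancels the decay of the tail and multiplies
    [d]. *)
Lemma strip_section m d x : (0 < m)%N -> 0 <= d -> 0 <= x <= 2^-1 ->
  (leb (xsection (strip m d) x) <=
   (96 / 4 ^+ m + 2 * (2 ^+ (2 ^ m + 2 ^ m.-1) * d))%:E)%E.
Proof.
move=> m0 d0 xh; have p0 : 0 < 2 ^+ m :> R by rewrite exprn_gt0.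
(* Rounding down gives a distance strictly below [2 ^- m], as [strip] requires. *)
pose i := Num.truncn (x * 2 ^+ m).
have /andP[xi xi1] : i%:R <= x * 2 ^+ m < i.+1%:R.
  by apply: truncn_itv; apply: mulr_ge0; [case/andP: xh|exact: ltW].
have im : (i <= 2 ^ m.-1)%N.
  rewrite -(ler_nat R) (le_trans xi)// natrX.
  have -> : 2 ^+ m.-1 = 2^-1 * 2 ^+ m :> R.
    by rewrite -[in RHS](prednK m0) exprS; field.
  by rewrite ler_pM2r//; case/andP: xh.
have xim : `|x - i%:R / 2 ^+ m| < 2 ^- m.
  have -> : x - i%:R / 2 ^+ m = (x * 2 ^+ m - i%:R) / 2 ^+ m.
    by field; rewrite gt_eqF.
  rewrite ger0_norm; last by rewrite divr_ge0 ?subr_ge0// ltW.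
  by rewrite -[ltRHS]mul1r ltr_pM2r ?invr_gt0// ltrBlDl natr1.
set k := (2 ^ m + i)%N; set r := 48 / 4 ^+ m * 2^-1 ^+ k + d.
have r0 : 0 <= r by rewrite addr_ge0// mulr_ge0 ?divr_ge0 ?exprn_ge0.
have sub : xsection (strip m d) x `<=`
    \bigcup_(u in [set: {ffun 'I_k -> bool}]) `[psum u x - r, psum u x + r]%classic.
  move=> y; rewrite /xsection/= inE => -[_ /(_ i im xim)[u /=]].
  by rewrite ler_distl => ur; exists u => //=; rewrite in_itv.
apply: le_trans (lebesgue_measure_subset sub) _.
have fT : finite_set [set: {ffun 'I_k -> bool}] by exact: finite_finset.
apply: le_trans (content_sub_fsum _ fT _ _ (@subset_refl _ _)) _ => //.
  by apply: fin_bigcup_measurable.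
rewrite (_ : (\sum_(u \in _) _ = \sum_(u : {ffun 'I_k -> bool}) (2 * r)%:E)%E).
  rewrite sumEFin lee_fin sumr_const card_ffun card_bool card_ord -[leLHS]mulr_natl natrX.
  have -> : 2 ^+ k * (2 * r) = 96 / 4 ^+ m + 2 * (2 ^+ k * d).
    rewrite /r exprVn; field.
    by rewrite !expf_neq0.
  rewrite lerD2l ler_pM2l// ler_wpM2r//.
  by rewrite ler_weXn2l ?ler1n// leq_add2l.
rewrite (_ : [set: _] = [set` index_enum {ffun 'I_k -> bool}]); last first.
  by apply/seteqP; split => u //= _; exact: mem_index_enum.
rewrite -fsbig_seq ?index_enum_uniq//; apply: eq_bigr => u _.
rewrite [LHS]lebesgue_measure_segment; last by move: r0; lra.
by congr (_%:E); ring.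
Qed.

Lemma leb2_strip_le m d : (0 < m)%N -> 0 <= d ->
  (leb2 (strip m d) <=
   (96 / 4 ^+ m + 2 * (2 ^+ (2 ^ m + 2 ^ m.-1) * d))%:E)%E.
Proof.
move=> m0 d0; set c := (X in (_ <= X%:E)%E).
have c0 : 0 <= c.
  by rewrite addr_ge0 ?divr_ge0 ?mulr_ge0 ?exprn_ge0.
apply: (@le_trans _ _ (\int[leb]_(x in `[0%R, 2^-1%R]) (cst c%:E) x)%E).
  rewrite [leRHS]integral_mkcond.
  apply: ge0_le_integralW => x _ /=; first exact: measure_ge0.
  rewrite patchE; case: ifPn => xh.
    by apply: strip_section => //; move: xh; rewrite inE/= in_itv.
  rewrite (_ : xsection _ _ = set0) ?measure0//.
  apply/seteqP; split => y //; rewrite /xsection/= inE => -[/= xh' _].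
  by move: xh; rewrite notin_setE/= in_itv/=.
rewrite integral_cst//= lebesgue_measure_segment; last by lra.
by rewrite -EFinM lee_fin subr0; lra.
Qed.

(** The zero digits give the zero polynomial, so the strip contains a rectangle of height
    [2 * d]. *)
Lemma leb2_strip_gt0 m d : 0 < d -> (0 < leb2 (strip m d))%E.
Proof.
move=> d0; apply: (@lt_le_trans _ _ (leb2 (`[0, 2^-1] `*` `[- d, d]))).
  rewrite /leb2 product_measure1E//= !lebesgue_measure_segment; [|lra..].
  by rewrite -EFinM lte_fin; nra.
apply: leb2_subset => -[x y] [/=]; rewrite !in_itv/= => xh yd.
split => //= i _ _; exists [ffun=> false].
rewrite (_ : psum _ _ = 0); last first.
  rewrite -[RHS](psum0 (2 ^ m + i) x).
  by apply: eq_bigr => j _; rewrite ffunE.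
rewrite subr0; apply: (@le_trans _ _ d); first by rewrite ler_norml.
by rewrite lerDr mulr_ge0 ?divr_ge0 ?exprn_ge0.
Qed.

End Measures.

(** * From dyadic scales to the logarithm *)

Section Scales.
Context {R : realType}.
Implicit Types (a d : R) (m n : nat).

Lemma dyadic_scale d : 0 < d < 16^-1 -> exists m, (0 < m)%N /\
  2^-1 ^+ (2 ^ m.+2) <= d < 2^-1 ^+ (2 ^ m.+1).
Proof.
move=> /andP[d0 d16].
pose P m := 2^-1 ^+ (2 ^ m.+2) <= d.
have exP : exists m, P m.
  pose n := (Num.truncn d^-1).+1.
  have dn : d^-1 < n%:R by exact: truncnS_gt.
  exists n; rewrite /P exprVn -[d]invrK lef_pV2 ?posrE ?invr_gt0 ?exprn_gt0//.
  apply: le_trans (ltW dn) _; rewrite -natrX ler_nat.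
  apply: leq_trans (ltnW (ltn_expl _ (isT : 1 < 2)%N)).
  by apply: leq_trans (ltnW (ltn_expl _ (isT : 1 < 2)%N)); lia.
(* The least [m] with [P m] is wanted; [m = 0] is excluded by [d < 16^-1], and minimality gives the
   upper bound on [d]. *)
case: (ex_minnP exP) => -[|m] Pm minm.
  by move: Pm; rewrite /P expnS/= !exprS expr0; lra.
exists m.+1; split => //; rewrite [X in X && _]Pm/= ltNge.
by apply/negP => /minm; rewrite ltnn.
Qed.

(** The factor 2 is there for [n = 3], where 9 exceeds 8. *)
Lemma sqr_le_exp2 n : (n ^ 2 <= 2 * 2 ^ n)%N.
Proof.
case: n => [|[|[|n]]]//; elim: n => [//|n IH].
by rewrite [X in (_ <= 2 * X)%N]expnS; nia.
Qed.

(** With [n = 2 ^ m.-1], the number of digits is at most [3 * n] while [d] is below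
    [2^-1 ^+ (4 * n)], so the thickening term is exponentially small in [n]. The lower bound on [d]
    makes [n] comparable to the logarithm. *)
Lemma dyadic_log_bound m d : (0 < m)%N ->
  2^-1 ^+ (2 ^ m.+2) <= d < 2^-1 ^+ (2 ^ m.+1) ->
  96 / 4 ^+ m + 2 * (2 ^+ (2 ^ m + 2 ^ m.-1) * d) <= 1792 / ln d^-1 ^+ 2.
Proof.
case: m => // m _ /=; set n := (2 ^ m)%N => /andP[dl du].
have n0 : (0 < n)%N by rewrite expn_gt0.
have nR : 1 <= n%:R :> R by rewrite ler1n.
have n2 : 0 < n%:R ^+ 2 :> R by rewrite exprn_gt0// ltr0n.
have dp : 0 < d by apply: lt_le_trans dl; rewrite exprn_gt0.
have E1 : (2 ^ m.+1 + n = 3 * n)%N by rewrite expnS -/n; lia.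
have E2 : (2 ^ m.+2 = n + 3 * n)%N by rewrite !expnS -/n; lia.
have E3 : (2 ^ m.+3 = 8 * n)%N by rewrite !expnS -/n; lia.
have E4 : 4 ^+ m.+1 = 4 * n%:R ^+ 2 :> R.
  by rewrite exprS /n natrX -exprM mulnC exprM; congr (_ * _ ^+ _); ring.
have L0 : 0 < ln d^-1.
  rewrite ln_gt0// invf_gt1// (lt_le_trans du)// exprn_ile1//; lra.
have Ln : ln d^-1 <= 8 * n%:R.
  have h : d^-1 <= 2 ^+ (8 * n).
    by rewrite -E3 -[leRHS]invrK lef_pV2 ?posrE ?invr_gt0 ?exprn_gt0// -exprVn.
  have : ln d^-1 <= ln (2 ^+ (8 * n)) by rewrite ler_ln ?posrE ?invr_gt0 ?exprn_gt0.
  rewrite lnXn// => /le_trans; apply.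
  rewrite -[leLHS]mulr_natr natrM -[leRHS]mul1r ler_wpM2r ?mulr_ge0//.
  by have := @le_ln1Dx R 1; rewrite (_ : 1 + 1 = 2)//; apply; lra.
rewrite E1 E4.
have h1 : 2 ^+ (3 * n) * d <= 2 / n%:R ^+ 2.
  apply: (@le_trans _ _ (2 ^+ (3 * n) * 2^-1 ^+ (n + 3 * n))).
    by rewrite ler_wpM2l ?exprn_ge0// -E2 ltW.
  rewrite exprD mulrCA !exprVn mulfV ?expf_neq0// mulr1.
  rewrite ler_pdivlMr//.
  rewrite mulrC ler_pdivrMr ?exprn_gt0// -!natrX -natrM ler_nat.
  exact: sqr_le_exp2.
apply: (@le_trans _ _ (28 / n%:R ^+ 2)).
  have -> : 28 / n%:R ^+ 2 = 96 / (4 * n%:R ^+ 2) + 2 * (2 / n%:R ^+ 2) :> R.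
    by field; lra.
  by rewrite lerD2l ler_pM2l.
(* The constant 1792 is 28 times the square of 8. *)
rewrite ler_pdivlMr ?exprn_gt0// mulrAC ler_pdivrMr//.
have : ln d^-1 ^+ 2 <= (8 * n%:R) ^+ 2 by rewrite lerXn2r// nnegrE; lra.
by lra.
Qed.

Lemma strip_log_bound : exists C : R, 0 < C /\
  forall d, 0 < d < 16^-1 -> exists m, (0 < m)%N /\
    (leb2 (strip m d) <= (C / ln d^-1 ^+ 2)%:E)%E.
Proof.
exists 1792; split => [|d dh]; first by rewrite ltr0n.
have [m [m0 dm]] := dyadic_scale dh; exists m; split => //.
apply: le_trans (leb2_strip_le m0 _) _; first by lra.
by rewrite lee_fin dyadic_log_bound.
Qed.

(** At thickness 0 only [96 / 4 ^+ m] remains, which tends to 0. *)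
Lemma leb2_kakeya : leb2 (@kakeya R) = 0%E.
Proof.
apply/eqP; rewrite eq_le measure_ge0 andbT.
apply/lee_addgt0Pr => e e0; rewrite add0e.
pose m := (Num.truncn (96 / e)).+1.
have em : 96 / e < m%:R by exact: truncnS_gt.
apply: (@le_trans _ _ (leb2 (@strip R m 0))).
  by apply: leb2_subset => z [_]; apply.
apply: le_trans (leb2_strip_le _ _) _ => //.
rewrite lee_fin !mulr0 addr0 ler_pdivrMr ?exprn_gt0// mulrC -ler_pdivrMr//.
apply: (le_trans (ltW em)); rewrite -natrX ler_nat.
exact/ltnW/ltn_expl.
Qed.

End Scales.

(** * Lower bounds for the maximal operator *)

Section MaximalFunction.
Context {R : realType}.
Implicit Types (a c d : R) (m : nat) (p q : \bar R).

Local Notation leb := (@lebesgue_measure R).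

(** Placed at the vertex of the arc in [kakeya], the thickened parabola lies in the strip for [t] in
    [0, 1/4], so there the inner integral is the full [2 * d]. *)
Lemma Pmax_strip m d a : (0 < m)%N -> 0 < d -> 1 <= a <= 2 ->
  ((4^-1)%:E <= Pmax d (\1_(strip m d)) a)%E.
Proof.
move=> m0 d0 a12; have [x1 [x2 [_ Kt]]] := kakeya_parabola a12.
apply: (@le_trans _ _ (((2 * d)^-1)%:E * (\int[leb]_(t in `[0%R, 1%R])
   \int[leb]_(s in `[(- d)%R, d])
     `|(\1_(strip m d) (x1 + t, x2 + a * t ^+ 2 + s)%R : R)|%:E))%E); last first.
  by apply: ereal_sup_ubound; exists (x1, x2).
apply: (@le_trans _ _ (((2 * d)^-1)%:E * (\int[leb]_(t in `[0%R, 1%R])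
   ((cst (2 * d)%:E) \_ `[0%R, 4^-1%R]) t))%E).
  rewrite -integral_mkcondr integral_cst/=; last exact: measurableI.
  rewrite (_ : _ `&` _ = `[0, 4^-1]%classic); last first.
    by apply/seteqP; split => t /=; rewrite !in_itv/=; lra.
  rewrite lebesgue_measure_segment; last by lra.
  rewrite -!EFinM lee_fin le_eqVlt; apply/orP; left; apply/eqP.
  by field; lra.
apply: lee_wpmul2l; first by rewrite lee_fin invr_ge0; lra.
apply: ge0_le_integralW => t _; rewrite patchE; case: ifPn => //.
- by move=> _ /=; rewrite lee_fin; lra.
- rewrite inE/= in_itv/= => t4.
  apply: (@le_trans _ _ (\int[leb]_(s in `[(- d)%R, d]) cst 1%:E s)%E).
    rewrite integral_cst//= lebesgue_measure_segment; last by lra.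
    by rewrite mul1e lee_fin; lra.
  apply: ge0_le_integralW => s //=; rewrite in_itv/= => sd.
  rewrite lee_fin indicE mem_set ?normr1//.
  apply: (vthicken_kakeya m0); exists (x1 + t, x2 + a * t ^+ 2); split.
    exact: Kt.
  by exists s.
- by move=> _; apply: integral_ge0 => s _; rewrite lee_fin.
Qed.

(** The interval [1, 2] has measure 1, so no power of its length enters. For infinite [q], an
    essential supremum below [c] would put [1, 2] inside a null set. *)
Lemma Lnorm_ge_segment q (f : R -> \bar R) c : (1 <= q)%E -> 0 < c ->
  (forall a, 1 <= a <= 2 -> (c%:E <= f a)%E) -> (c%:E <= Lnorm leb q f)%E.
Proof.
move=> q1 c0 fc; rewrite unlock; case: q q1 => [r r1| _|//].
- rewrite lee_fin in r1; have r0 : 0 < r by lra.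
  apply: (@le_trans _ _ ((\int[leb]_(a in `[1%R, 2%R]) cst (c `^ r)%:E a) `^ r^-1)%E).
    rewrite integral_cst//= lebesgue_measure_segment; last by lra.
    rewrite (_ : 2 - 1 = 1); last by ring.
    by rewrite mule1 poweR_EFin -powRrM mulfV ?gt_eqF// powRr1// ltW.
  have ri : 0 <= r^-1 by rewrite invr_ge0 ltW.
  apply: (gt0_ler_poweR ri); rewrite ?in_itv/= ?leey ?andbT.
  + by apply: integral_ge0 => a _; rewrite lee_fin powR_ge0.
  + by apply: integral_ge0 => a _; exact: poweR_ge0.
  rewrite [leLHS]integral_mkcond; apply: ge0_le_integralW => a _.
    by rewrite patchE; case: ifPn => // _; rewrite lee_fin powR_ge0.
  rewrite patchE; case: ifPn => [|_]; last exact: poweR_ge0.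
  rewrite inE/= in_itv/= => /fc cf; rewrite -poweR_EFin.
  apply: (gt0_ler_poweR (ltW r0)); rewrite ?in_itv/= ?leey ?andbT//.
    by rewrite lee_fin ltW.
  exact: le_trans cf (lee_abs _).
- rewrite ifT; last first.
    apply: (@lt_le_trans _ _ (leb `[0%R, 1%R])).
      by rewrite lebesgue_measure_segment ?subr0.
    exact: lebesgue_measure_subset.
  rewrite leNgt; apply/negP => lt_c.
  have [N [mN N0 fN]] := ess_sup_ge leb (abse \o f).
  have : (leb `[1%R, 2%R] <= leb N)%E.
    apply: lebesgue_measure_subset => a; rewrite /= in_itv/= => a12.
    apply: fN => /= fa; have := le_trans (le_trans (fc a a12) (lee_abs _)) fa.
    by rewrite leNgt lt_c.
  rewrite N0 lebesgue_measure_segment; last by lra.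
  by rewrite lee_fin; lra.
Qed.

Lemma Lnorm_indic (dT : measure_display) (T : measurableType dT)
    (mu : {measure set T -> \bar R}) (E : set T) (r : R) :
  measurable E -> 0 < r ->
  Lnorm mu r%:E (fun x => (\1_E x)%:E) = (mu E `^ r^-1)%E.
Proof.
move=> mE r0; rewrite unlock; congr (_ `^ _)%E.
rewrite -[in RHS](setIT E) -integral_indic//; apply: eq_integral => x _.
rewrite indicE; case: (x \in E) => /=; first by rewrite normr1 powR1.
by rewrite normr0 powR0// gt_eqF.
Qed.

Lemma Lnorm_indicy (dT : measure_display) (T : measurableType dT)
    (mu : {measure set T -> \bar R}) (E : set T) : measurable E ->
  (0 < mu E)%E -> Lnorm mu +oo%E (fun x => (\1_E x)%:E) = 1%E.
Proof.
(* The norm at infinity is an essential supremum only when the whole space has positive measure. *)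
move=> mE E0; rewrite unlock ifT; last first.
  by apply: lt_le_trans E0 _; apply: le_measure; rewrite ?inE.
apply/eqP; rewrite eq_le; apply/andP; split.
  apply/ess_supP; apply: nearW => x /=; rewrite lee_fin indicE.
  by case: (x \in E); rewrite ?normr1 ?normr0.
rewrite leNgt; apply/negP => lt1.
have [N [mN N0 fN]] := ess_sup_ge mu (abse \o (fun x => (\1_E x : R)%:E)).
have : (mu E <= mu N)%E.
  apply: le_measure; rewrite ?inE// => x Ex; apply: fN => /=.
  by rewrite indicE mem_set//= normr1 leNgt lt1.
by rewrite N0 leNgt E0.
Qed.

(** The test function is the indicator of the strip. *)
Lemma Bpq_ge p q m d : (0 < m)%N -> 0 < d -> (1 <= q)%E ->
  (0 < Lnorm leb2 p (fun x => (\1_(strip m d) x)%:E) < +oo)%E ->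
  ((4^-1 * (fine (Lnorm leb2 p (fun x => (\1_(strip m d) x)%:E)))^-1)%:E
   <= Bpq p q d)%E.
Proof.
move=> m0 d0 q1 N0.
apply: (@le_trans _ _ (Lnorm leb q (Pmax12 d (\1_(strip m d))) *
    ((fine (Lnorm leb2 p (fun x => (\1_(strip m d) x)%:E)))^-1)%:E)%E).
  rewrite EFinM; apply: lee_wpmul2r.
    by rewrite lee_fin invr_ge0 fine_ge0// ltW//; case/andP: N0.
  apply: Lnorm_ge_segment => // a a12.
  by rewrite /Pmax12 a12; exact: Pmax_strip.
apply: ereal_sup_ubound; exists (\1_(strip m d)) => //=; split => //.
exact: measurable_indic (measurable_strip m d).
Qed.

Lemma Bpq_lower_bound p q : (1 <= p)%E -> (1 <= q)%E ->
  exists c, 0 < c /\ exists d0, 0 < d0 /\ forall d, 0 < d < d0 ->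
    ((c * ln d^-1 `^ two_over p)%:E <= Bpq p q d)%E.
Proof.
case: p => [r||//] p1 q1.
- rewrite lee_fin in p1; have r0 : 0 < r by lra.
  have [C [C0 stripC]] := @strip_log_bound R.
  exists (4^-1 * (C `^ r^-1)^-1); split.
    by rewrite mulr_gt0 ?invr_gt0 ?powR_gt0.
  exists 16^-1; split => // d dh; have [m [m0 md]] := stripC d dh.
  have d0 : 0 < d by case/andP: dh.
  have L0 : 0 < ln d^-1 by rewrite ln_gt0// invf_gt1//; lra.
  have s0 : (0 < leb2 (strip m d))%E by exact: leb2_strip_gt0.
  have sfin : leb2 (strip m d) \is a fin_num.
    by rewrite ge0_fin_numE ?ltW//; exact: le_lt_trans md (ltry _).
  have NE : Lnorm leb2 r%:E (fun x => (\1_(strip m d) x)%:E) =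
      (fine (leb2 (strip m d)) `^ r^-1)%:E.
    by rewrite Lnorm_indic//; [rewrite -poweR_EFin fineK|exact: measurable_strip].
  have f0 : 0 < fine (leb2 (strip m d)).
    by rewrite fine_gt0// s0; exact: le_lt_trans md (ltry _).
  apply: le_trans (Bpq_ge (p := r%:E) m0 d0 q1 _); last first.
    by rewrite NE lte_fin powR_gt0// ltry.
  rewrite NE /= lee_fin -mulrA ler_pM2l//.
  rewrite -[leRHS]mul1r ler_pdivlMr ?powR_gt0// -mulrA mulrC.
  rewrite ler_pdivrMr ?powR_gt0// mul1r.
  (* Everything is now a power [r^-1], so the claim reduces to the logarithmic bound on the measure
     of the strip. *)
  rewrite /two_over powRrM (powR_mulrn 2 (ltW L0)) -(powRM _ (sqr_ge0 _) (ltW f0)).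
  apply: ge0_ler_powR; rewrite ?invr_ge0 ?nnegrE//; first exact: ltW.
  - by apply: mulr_ge0; [exact: sqr_ge0|exact: ltW].
  - exact: ltW.
  by rewrite mulrC -ler_pdivlMr ?exprn_gt0// -lee_fin fineK.
(* For infinite [p] the exponent [two_over p] is 0 and the indicator has norm 1, so the fixed scale
   1 suffices. *)
- exists 4^-1; split => //; exists 16^-1; split => // d dh.
  have d0 : 0 < d by case/andP: dh.
  have NE : Lnorm leb2 +oo%E (fun x => (\1_(strip 1 d) x)%:E) = 1%E.
    by apply: Lnorm_indicy; [exact: measurable_strip|exact: leb2_strip_gt0].
  apply: le_trans (Bpq_ge (p := +oo%E) (isT : 0 < 1)%N d0 q1 _); last first.
    by rewrite NE lte01 ltry.
  by rewrite NE /= invr1 powRr0.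
Qed.

End MaximalFunction.

Theorem theorem1p2 (R : realType) :
  (exists K : set (R * R),
    compact K /\ leb2 K = 0%E /\
    (exists c : R, 0 < c /\
       forall a : R, 1 <= a <= 2 ->
         exists (x1 x2 u v : R),
           0 <= u /\ u <= v /\ v <= 1 /\ c <= v - u /\
           (forall t : R, u <= t <= v -> K (x1 + t, x2 + a * t ^+ 2))) /\
    (exists C : R, exists delta0 : R, 0 < delta0 /\
       forall delta : R, 0 < delta < delta0 ->
         (leb2 (vthicken K delta) <= (C / (ln (delta^-1)) ^+ 2)%:E)%E)) /\
  (forall p q : \bar R, (1 <= p)%E -> (1 <= q)%E ->
    exists cpq : R, 0 < cpq /\
      exists delta0 : R, 0 < delta0 /\
        forall delta : R, 0 < delta < delta0 ->
          ((cpq * (ln (delta^-1)) `^ (two_over p))%:E <= Bpq p q delta)%E).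
Proof.
split; last by move=> p q; exact: Bpq_lower_bound.
exists kakeya; split; first exact: compact_kakeya.
split; first exact: leb2_kakeya.
split.
  exists 4^-1; split => // a a12.
  have [x1 [x2 [_ Kt]]] := kakeya_parabola a12.
  by exists x1, x2, 0, 4^-1; split => //; split; [lra|split; [lra|split; [lra|]]].
have [C [C0 stripC]] := @strip_log_bound R.
exists C, 16^-1; split => // delta dh.
(* The scale depends on [delta], but the set [kakeya] lies in the strips of all scales. *)
have [m [m0 md]] := stripC delta dh.
exact: le_trans (leb2_subset (vthicken_kakeya m0)) md.
Qed.
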